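(* Assume that $v_0 \in C^1_0$ in the initial-value problem $$v_t = (c - \varphi) v_x + \varphi w - \pi m^2 \bar{v} \sinh(x), \quad t>0, \qquad v|_{t=0} = v_0,$$ where $w(t,x) := \int_0^x v(t,y)\,dy$ and $\bar v(t) := \frac{1}{2\pi}\int_{-\pi}^{\pi} v(t,y)\,dy$, and let $v$ be its solution. Then it follows that $$\| v(t,\cdot) \|_{H^1(\mathbb{T})}^2 = C_+ e^{t} + C_0 + C_- e^{-t},$$ for some uniquely defined constants $C_+, C_0, C_-$.
   Context: $\mathbb{T} = [-\pi,\pi]$ with periodic boundary conditions at $\pm\pi$; $t\in\mathbb{R}^+$. $\varphi(x) = \cosh(\pi - |x|)/\sinh(\pi)$ for $x\in\mathbb{T}$, $m = 1/\sinh(\pi)$, $c = \varphi(0) = \coth(\pi)$. $\|f\|_{H^1(\mathbb{T})}^2 = \int_{\mathbb{T}}(f^2+f_x^2)\,dx$. $C^1_{0} := \{ v \in H^1_{\rm per}(\mathbb{T})\cap W^{1,\infty}(\mathbb{T}) : v_x \in C(\mathbb{T}\setminus \{0\}) \}$. The solution is the unique solution $v \in C^1(\mathbb{R}^+,C^1_0)$ of the initial-value problem, the equation being posed for $x\in\mathbb{T}$ piecewise on both sides of the peak at $x=0$. *)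

(* Defs.v *)
From HB Require Import structures.
From mathcomp Require Import all_boot all_order all_algebra.
From mathcomp Require Import all_classical all_reals all_analysis.

Set Implicit Arguments.
Unset Strict Implicit.
Unset Printing Implicit Defensive.
Import Order.TTheory GRing.Theory Num.Theory.
Import numFieldNormedType.Exports.
Local Open Scope classical_set_scope.
Local Open Scope ring_scope.

Definition cosh {R : realType} (x : R) : R := (expR x + expR (- x)) / 2.
Definition sinh {R : realType} (x : R) : R := (expR x - expR (- x)) / 2.

(* A function on the circle T is represented by its 2 pi-periodic extension
   R -> R; Tdom is the fundamental domain over which one integrates. *)
Definition Tdom {R : realType} : set R := `[- pi, pi]%classic.

Definition periodicT {R : realType} (f : R -> R) : Prop :=
  periodic f (pi *+ 2).

Definition LpT {R : realType} (p : \bar R) (f : R -> R) : Prop :=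
  f \_ Tdom \in Lfun (@lebesgue_measure R) p.

Definition smoothT {R : realType} (psi : R -> R) : Prop :=
  periodicT psi /\ forall (n : nat) (x : R), derivable (derive1n n psi) x 1.

Definition weak_derivT {R : realType} (f g : R -> R) : Prop :=
  forall psi : R -> R, smoothT psi ->
    \int[lebesgue_measure]_(x in Tdom) (f x * derive1 psi x) =
    - \int[lebesgue_measure]_(x in Tdom) (g x * psi x).

(* The Sobolev space W^{1,p}_per(T), p >= 1, for the continuous representative
   f.  That representative is absolutely continuous, so its weak derivative,
   when it exists in L^p, is the almost everywhere classical derivative
   derive1 f (a total function, whose values where f is not
   derivable are irrelevant). *)
Definition W1pT {R : realType} (p : \bar R) (f : R -> R) : Prop :=
  [/\ periodicT f, continuous f, LpT p f, LpT p (derive1 f) &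
      weak_derivT f (derive1 f)].

Definition H1T {R : realType} (f : R -> R) : Prop := W1pT 2%:E f.

(* f_x is continuous on T \ {0}; at x = pi and x = - pi this is continuity on
   the circle, by periodicity. *)
Definition C10 {R : realType} (f : R -> R) : Prop :=
  [/\ H1T f, W1pT +oo%E f &
      forall x, Tdom x -> x != 0 ->
        derivable f x 1 /\ {for x, continuous (derive1 f)}].

Definition H1sqnorm {R : realType} (f : R -> R) : R :=
  \int[lebesgue_measure]_(x in Tdom) (f x ^+ 2 + derive1 f x ^+ 2).

(* The norm of C10; it dominates the H^1 norm because T is bounded. *)
Definition W1ooNorm {R : realType} (f : R -> R) : \bar R :=
  ('N[@lebesgue_measure R]_+oo[EFin \o (f \_ Tdom)] +
   'N[@lebesgue_measure R]_+oo[EFin \o (derive1 f \_ Tdom)])%E.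

(* v is in C^1([0, +oo), C10), with derivative vt : the difference quotients
   converge in the norm of C10 (one-sidedly at t = 0), and vt is continuous. *)
Definition C1_time_C10 {R : realType} (v vt : R -> R -> R) : Prop :=
  forall t : R, 0 <= t ->
    [/\ C10 (v t), C10 (vt t),
        W1ooNorm (fun x => (v s x - v t x) / (s - t) - vt t x)
          @[s --> within `[0, +oo[%classic (t^')] --> 0%E &
        W1ooNorm (fun x => vt s x - vt t x)
          @[s --> within `[0, +oo[%classic (nbhs t)] --> 0%E].

(* To be evaluated on [- pi, pi] only. *)
Definition peakon {R : realType} (x : R) : R := cosh (pi - `|x|) / sinh pi.

Definition mconst {R : realType} : R := 1 / sinh pi.
Definition cconst {R : realType} : R := peakon 0.

(* The oriented integral of f from 0 to x; for either sign of x, one of the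
   two domains is negligible. *)
Definition prim0 {R : realType} (f : R -> R) (x : R) : R :=
  \int[lebesgue_measure]_(y in `[0, x]) f y
  - \int[lebesgue_measure]_(y in `[x, 0]) f y.

Definition meanT {R : realType} (f : R -> R) : R :=
  (2 * pi)^-1 * \int[lebesgue_measure]_(y in Tdom) f y.

Definition lin_rhs {R : realType} (f : R -> R) (x : R) : R :=
  (cconst - peakon x) * derive1 f x + peakon x * prim0 f x
  - pi * mconst ^+ 2 * meanT f * sinh x.

Definition is_solution {R : realType} (v0 : R -> R) (v : R -> R -> R) : Prop :=
  exists2 vt : R -> R -> R, C1_time_C10 v vt &
    (forall t x, 0 < t -> Tdom x -> x != 0 -> vt t x = lin_rhs (v t) x)
    /\ v 0 = v0.

(* Main.v *)
Require Import Defs.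
From HB Require Import structures.
From mathcomp Require Import all_boot all_order all_algebra.
From mathcomp Require Import all_classical all_reals all_analysis.
From mathcomp Require Import measurable_realfun ess_sup_inf.
From mathcomp Require Import ring lra.
Set Implicit Arguments.
Unset Strict Implicit.
Unset Printing Implicit Defensive.
Import Order.TTheory GRing.Theory Num.Theory.
Import numFieldNormedType.Exports.
Local Open Scope classical_set_scope.
Local Open Scope ring_scope.

(** On T \ {0} = (0, 2 pi), write phi = cosh(pi - x) / sinh pi, psi = phi' and
    W(x) = int_0^x v; the equation becomes
      v_t = (c - phi) v_x + phi W - k sinh x,  k = m^2 W(2 pi) / 2,
    with smooth coefficients. The point value v(t, 0) and the mean of v are
    conserved, and the three energies
      N = int v^2 + v_x^2,  P = int psi (2 v^2 + v_x^2),  Q = int phi (2 v^2 + v_x^2)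
    satisfy N' = - P, P' = m^2 N - c Q + K, Q' = - c P with a constant K: in each
    case the integrand of the defect is an exact x-derivative, whose boundary
    terms at the peak are explicit. As c^2 - m^2 = 1 and Q - c N is conserved,
    N - k' and P satisfy N' = - P, P' = k' - N for a constant k', whence the
    modes e^t, 1, e^-t. *)

(** * Integrals of bounded continuous functions *)

(** The difficulty is regularity at the peak. The derivative of a function in [C10] is continuous
    and bounded on (0, 2 pi) but may have no one-sided limits at the peak, and no second space
    derivative is assumed. Hence [bounded_cont]: integrands are continuous and bounded on an open
    interval, and nothing is asked at its ends. Every boundary term containing v_x^2 carries the
    factor c - phi, which vanishes at the peak, so a bound on v_x is enough there; inside the
    interval c - phi > 0. In time, the equation holds for t > 0 only and the derivative at t = 0 is
    one-sided. Conservation laws are therefore derived for t > 0 and carried to t = 0 by continuity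
    from the right. *)

Definition bounded_cont {R : realType} (a b : R) (f : R -> R) : Prop :=
  {in `]a, b[, continuous f} /\
  exists M : R, forall x, x \in `]a, b[ -> `|f x| <= M.

Section bounded_continuous.
Context {R : realType} (a b : R).
Implicit Types f g F : R -> R.
Notation mu := (@lebesgue_measure R).

Lemma bounded_contD f g :
  bounded_cont a b f -> bounded_cont a b g -> bounded_cont a b (fun x => f x + g x).
Proof.
move=> [cf [M fM]] [cg [K gK]]; split=> [x xab|].
  by apply: cvgD; [exact: cf|exact: cg].
by exists (M + K) => x xab; rewrite (le_trans (ler_normD _ _))// lerD ?fM ?gK.
Qed.

Lemma bounded_contM f g :
  bounded_cont a b f -> bounded_cont a b g -> bounded_cont a b (fun x => f x * g x).
Proof.
move=> [cf [M fM]] [cg [K gK]]; split=> [x xab|].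
  by apply: cvgM; [exact: cf|exact: cg].
by exists (M * K) => x xab; rewrite normrM ler_pM// ?fM ?gK.
Qed.

Lemma bounded_cont_cst (k : R) : bounded_cont a b (fun=> k).
Proof. by split=> [x _|]; [exact: cvg_cst|exists `|k|]. Qed.

Lemma bounded_contN f : bounded_cont a b f -> bounded_cont a b (fun x => - f x).
Proof.
move=> [cf [M fM]]; split=> [x xab|]; first by apply: cvgN; exact: cf.
by exists M => x xab; rewrite normrN fM.
Qed.

Lemma bounded_contB f g :
  bounded_cont a b f -> bounded_cont a b g -> bounded_cont a b (fun x => f x - g x).
Proof. by move=> bf bg; apply: bounded_contD => //; exact: bounded_contN. Qed.

Lemma bounded_cont_continuous f : continuous f -> bounded_cont a b f.
Proof.
move=> cf; split=> [x _|]; first exact: cf.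
have [ab|ba] := leP a b; last first.
  by exists 0 => x; rewrite in_itv/= => /andP[ax xb]; lra.
have cfab : {within `[a, b], continuous f} by exact: continuous_subspaceT.
have [u _ fu] := EVT_max ab cfab; have [l _ fl] := EVT_min ab cfab.
exists (`|f u| + `|f l|) => x /subset_itv_oo_cc xab.
have := fu _ xab; have := fl _ xab; have := ler_norm (f u).
have := ler_norm (- f l); rewrite normrN; have := normr_ge0 (f u).
have := normr_ge0 (f l); rewrite ler_norml; move: `|f u| `|f l| => A B; lra.
Qed.

Lemma bounded_cont_integrable f :
  bounded_cont a b f -> mu.-integrable `]a, b[ (EFin \o f).
Proof.
move=> [cf [M fM]]; apply: measurable_bounded_integrable => //=.
- by rewrite lebesgue_measure_itv/=; case: ifPn => // _; rewrite -EFinB ltry.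
- by apply: open_continuous_measurable_fun => //; apply/in_continuous_mksetP.
- exists M; split; rewrite ?num_real// => y My x xab.
  exact: le_trans (fM _ xab) (ltW My).
Qed.

Lemma Rintegral_bounded_contD f g : bounded_cont a b f -> bounded_cont a b g ->
  \int[mu]_(x in `]a, b[) (f x + g x) =
  \int[mu]_(x in `]a, b[) f x + \int[mu]_(x in `]a, b[) g x.
Proof.
by move=> /bounded_cont_integrable ? /bounded_cont_integrable ?; rewrite RintegralD.
Qed.

Lemma Rintegral_bounded_contB f g : bounded_cont a b f -> bounded_cont a b g ->
  \int[mu]_(x in `]a, b[) (f x - g x) =
  \int[mu]_(x in `]a, b[) f x - \int[mu]_(x in `]a, b[) g x.
Proof.
by move=> /bounded_cont_integrable ? /bounded_cont_integrable ?; rewrite RintegralB.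
Qed.

Lemma Rintegral_bounded_contZ k f : bounded_cont a b f ->
  \int[mu]_(x in `]a, b[) (k * f x) = k * \int[mu]_(x in `]a, b[) f x.
Proof. by move=> /bounded_cont_integrable ?; rewrite RintegralZl. Qed.

Lemma normr_Rintegral_bounded f (M : R) : a <= b -> {in `]a, b[, continuous f} ->
  (forall x, x \in `]a, b[ -> `|f x| <= M) ->
  `|\int[mu]_(x in `]a, b[) f x| <= M * (b - a).
Proof.
move=> ab cf fM; have bf : bounded_cont a b f by split => //; exists M.
apply: (le_trans (le_normr_Rintegral _ _)) => //.
  exact: bounded_cont_integrable.
have -> : M * (b - a) = \int[mu]_(x in `]a, b[) (cst M) x.
  rewrite Rintegral_cst//= lebesgue_measure_itv/= lte_fin.
  case: ltP => [//|ba]; have -> : b = a by lra.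
  by rewrite subrr.
apply: le_Rintegral => //; first 1 last.
- have bM : bounded_cont a b (cst M) by exact: bounded_cont_cst.
  have := bounded_cont_integrable bM. exact.
- by move: (bounded_cont_integrable bf) => /integrable_norm.
Qed.

(** The end points form a null set, so arbitrary values there, such as that of a derivative at the
    peak, do no harm. *)
Lemma bounded_cont_integrable_cc f :
  bounded_cont a b f -> mu.-integrable `[a, b] (EFin \o f).
Proof.
move=> /bounded_cont_integrable/integrableP[mf foo]; apply/integrableP.
split.
  by apply/emeasurable_fun_itv_obnd_cbndP/emeasurable_fun_itv_bndo_bndcP.
rewrite -integral_itv_obnd_cbnd -?integral_itv_bndo_bndc//.
  exact: measurableT_comp.
by apply/emeasurable_fun_itv_bndo_bndcP; exact: measurableT_comp.
Qed.

Lemma Rintegral_bounded_cont_cc f : bounded_cont a b f ->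
  \int[mu]_(x in `[a, b]) f x = \int[mu]_(x in `]a, b[) f x.
Proof.
move=> bf; have fi := bounded_cont_integrable bf.
rewrite Rintegral_itv_bndo_bndc// Rintegral_itv_obnd_cbnd//.
apply: integrableS (bounded_cont_integrable_cc bf) => //.
exact: subset_itv_oc_cc.
Qed.

Lemma is_derive0_cst_oo F x y :
  (forall z, z \in `]a, b[ -> is_derive z 1 F 0) ->
  x \in `]a, b[ -> y \in `]a, b[ -> F x = F y.
Proof.
move=> dF; wlog xy : x y / x <= y => [wH xab yab|].
  by case: (leP x y) => [/wH|/ltW/wH ->//]; exact.
rewrite !in_itv/= => /andP[ax xb] /andP[ay yb].
have dFxy z : z \in `[x, y] -> is_derive z 1 F 0.
  rewrite in_itv/= => /andP[xz zy]; apply: dF.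
  by rewrite in_itv/= (lt_le_trans ax xz) (le_lt_trans zy yb).
have cF : {within `[x, y], continuous F}.
  by apply: derivable_within_continuous => z /dFxy -[].
have dFo z : z \in `]x, y[ -> is_derive z 1 F ((fun=> 0) z).
  by move=> /subset_itv_oo_cc; exact: dFxy.
by have [z _] := MVT_segment xy dFo cF; rewrite mul0r; lra.
Qed.

(** [F] minus the integral of [f] from [a] has zero derivative, hence is constant on the open
    interval; comparing its limits at the two ends gives the formula. Only one-sided limits of [F]
    are used, because the primitives met later are controlled inside the interval only. *)
Lemma bounded_cont_FTC2 f F la lb : a < b -> bounded_cont a b f ->
  (forall x, x \in `]a, b[ -> is_derive x 1 F (f x)) ->
  F x @[x --> a^'+] --> la -> F x @[x --> b^'-] --> lb ->
  \int[mu]_(x in `]a, b[) f x = lb - la.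
Proof.
move=> ab bf dF Fa Fb; have [cf _] := bf.
have fi := bounded_cont_integrable_cc bf.
pose H x := \int[mu]_(t in `[a, x]) f t.
have dH x : x \in `]a, b[ -> is_derive x 1 H (f x).
  move=> xab; have := xab; rewrite in_itv/= => /andP[ax xb].
  have [dH Hf] := continuous_FTC1_closed xb fi ax (cf _ xab).
  by rewrite -Hf derive1E; exact: derivableP.
have Ha : H x @[x --> a^'+] --> 0.
  apply: cvg_within_filter; exact: parameterized_integral_cvg_left ab fi.
have Hb : H x @[x --> b^'-] --> H b.
  exact: parameterized_integral_cvg_at_left ab fi.
pose m := (a + b) / 2.
have mab : m \in `]a, b[ by rewrite in_itv/= /m; lra.
have FH x : x \in `]a, b[ -> F x - H x = F m - H m.
  move=> xab; apply: (@is_derive0_cst_oo (fun z => F z - H z)) => // z zab.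
  by have ? := dF _ zab; have ? := dH _ zab; apply: is_derive_eq; rewrite subrr.
rewrite -Rintegral_bounded_cont_cc//.
have Ea : la - 0 = F m - H m.
  have Ca : F x - H x @[x --> a^'+] --> la - 0 by exact: cvgB.
  apply: (cvg_unique _ Ca) => //.
  apply: cvg_near_cst; near=> x; apply: FH; rewrite in_itv/=; apply/andP; split.
    by near: x; exact: nbhs_right_gt.
  by near: x; exact: nbhs_right_lt.
have Eb : lb - H b = F m - H m.
  have Cb : F x - H x @[x --> b^'-] --> lb - H b by exact: cvgB.
  apply: (cvg_unique _ Cb) => //.
  apply: cvg_near_cst; near=> x; apply: FH; rewrite in_itv/=; apply/andP; split.
    by near: x; exact: nbhs_left_gt.
  by near: x; exact: nbhs_left_lt.
by rewrite -/(H b); lra.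
Unshelve. all: by end_near. Qed.

End bounded_continuous.

(** * The circle as (0, 2 pi) *)

Section periodic.
Context {R : realType}.
Implicit Types f g : R -> R.
Notation mu := (@lebesgue_measure R).
Notation T := (pi *+ 2 : R).

Lemma two_pi_gt0 : 0 < T.
Proof. by rewrite pmulrn_lgt0// pi_gt0. Qed.

Lemma periodicTB f x : periodicT f -> f (x - T) = f x.
Proof. by move=> fT; rewrite -[in RHS](subrK T x) fT. Qed.

Lemma is_derive_periodic f (x d : R) :
  periodicT f -> is_derive x 1 f d -> is_derive (x + T) 1 f d.
Proof.
move=> fT dfx.
have -> : f = f \o shift (- T) by apply/funext => z /=; rewrite periodicTB.
rewrite -[d]mulr1; apply: is_derive1_comp; last exact: is_derive_shift.
by rewrite /= addrK.
Qed.

Lemma derive1_periodic f : periodicT f -> periodicT (derive1 f).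
Proof.
move=> fT x; rewrite /derive1.
suff -> : (fun h => h^-1 *: (f (h + (x + T)) - f (x + T))) =
          (fun h => h^-1 *: (f (h + x) - f x)) by [].
by apply/funext => h; rewrite addrA !fT.
Qed.

Lemma continuous_periodic f (x : R) :
  periodicT f -> {for x, continuous f} -> {for x + T, continuous f}.
Proof.
move=> fT cf.
have -> : f = f \o (fun z => z - T) by apply/funext => z /=; rewrite periodicTB.
apply: (@continuous_comp _ _ _ (fun z => z - T) f).
  by apply: cvgB; [exact: cvg_id|exact: cvg_cst].
by rewrite addrK.
Qed.

Lemma continuous_periodicB f (x : R) :
  periodicT f -> {for x + T, continuous f} -> {for x, continuous f}.
Proof.
move=> fT cf.
have -> : f = f \o (fun z => z + T) by apply/funext => z /=; rewrite fT.
apply: (@continuous_comp _ _ _ (fun z => z + T) f) => //.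
by apply: cvgD; [exact: cvg_id|exact: cvg_cst].
Qed.

(** The hypotheses live on [- pi, pi] without the peak, the computations on (0, 2 pi): a point
    beyond pi is moved back by one period. *)
Lemma circle_itvP (x : R) : x \in `]0, T[ ->
  (Tdom x /\ x != 0) \/ (Tdom (x - T) /\ x - T != 0).
Proof.
rewrite in_itv/= => /andP[x0 xT]; have p0 := pi_gt0 R.
have [xp|px] := leP x pi; [left|right]; split.
- by rewrite /Tdom/= in_itv/=; apply/andP; split; lra.
- by rewrite gt_eqF.
- by rewrite /Tdom/= in_itv/= -mulr_natr; move: xT; rewrite -mulr_natr => xT;
    apply/andP; split; lra.
- by rewrite lt_eqF// subr_lt0.
Qed.

Lemma C10_derive f x : C10 f -> x \in `]0, T[ -> is_derive x 1 f (derive1 f x).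
Proof.
move=> [[fT _ _ _ _] _ fd] /circle_itvP[[xD x0]|[xD x0]].
  by have [df _] := fd _ xD x0; rewrite derive1E; exact: derivableP.
have [df _] := fd _ xD x0; rewrite -{1}(subrK T x).
apply: is_derive_periodic => //.
by rewrite -(periodicTB x (derive1_periodic fT)) derive1E; exact: derivableP.
Qed.

Lemma C10_continuous_derive1 f x : C10 f -> x \in `]0, T[ ->
  {for x, continuous (derive1 f)}.
Proof.
move=> [[fT _ _ _ _] _ fd] /circle_itvP[[xD x0]|[xD x0]].
  by have [_] := fd _ xD x0.
have [_] := fd _ xD x0; rewrite -{2}(subrK T x).
exact/continuous_periodic/derive1_periodic.
Qed.

(** The set where [|f|] exceeds an essential bound is null, so it contains no interval of positive
    length. *)
Lemma Lnorm_oo_oo_le f (a b M : R) : a < b -> `]a, b[ `<=` @Tdom R ->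
  ('N[mu]_+oo[EFin \o (f \_ Tdom)] <= M%:E)%E ->
  ~ (forall y, y \in `]a, b[ -> M < `|f y|).
Proof.
move=> ab abT fM Mf.
have : (ess_sup mu (abse \o (EFin \o (f \_ Tdom))) <= M%:E)%E.
  have mT : (0 < mu [set: R])%E by rewrite -set_itvNyy lebesgue_measure_itv/= ltry.
  by move: fM; rewrite unlock mT.
move=> /ess_supP [N [mN N0 HN]].
have : (mu `]a, b[ <= mu N)%E.
  apply: le_measure; rewrite ?inE// => y yab; apply: HN => /=.
  rewrite patchE mem_set/=; last exact: abT.
  by rewrite lee_fin leNgt Mf.
by rewrite N0 lebesgue_measure_itv/= lte_fin ab -EFinB lee_fin; lra.
Qed.

Lemma Lnorm_oo_le f (M : R) x : periodicT f ->
  x \in `]0, T[ -> {for x, continuous f} ->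
  ('N[mu]_+oo[EFin \o (f \_ Tdom)] <= M%:E)%E -> `|f x| <= M.
Proof.
move=> fT + cf fM; rewrite in_itv/= => /andP[x0 xT]; rewrite leNgt; apply/negP => Mx.
have p0 := pi_gt0 R.
have : \forall y \near x, M < `|f y|.
  have : `|f y| @[y --> x] --> `|f x| by apply: cvg_norm; exact: cf.
  by move/cvgr_gt; apply.
move=> /nbhs_ballP[d /= d0 Hd].
have [xp|px] := leP x pi.
(* Only the left half of the neighbourhood is kept, cut off at 0, so that it stays inside the
   fundamental domain even for x = pi. *)
- apply: (@Lnorm_oo_oo_le f (Num.max 0 (x - d)) x M) => //.
  + by rewrite gt_max x0/=; lra.
  + move=> y /=; rewrite /Tdom/= !in_itv/= gt_max => /andP[/andP[? ?] ?].
    by apply/andP; split; lra.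
  + move=> y; rewrite in_itv/= gt_max => /andP[/andP[? ?] ?]; apply: Hd.
    by rewrite /ball/= ger0_norm; lra.
- move: xT; rewrite -mulr_natr => xT.
  (* After translation by one period the point may be close to - pi, so here the right half is kept,
     again cut off at 0. *)
  apply: (@Lnorm_oo_oo_le f (x - T) (Num.min 0 (x - T + d)) M) => //.
  + by rewrite lt_min -mulr_natr; apply/andP; split; lra.
  + move=> y /=; rewrite /Tdom/= !in_itv/= lt_min -mulr_natr.
    by move=> /andP[? /andP[? ?]]; apply/andP; split; lra.
  + move=> y; rewrite in_itv/= lt_min => /andP[? /andP[? ?]].
    by rewrite -fT; apply: Hd; rewrite /ball/= ler0_norm; lra.
Qed.

Lemma C10_bounded_cont f : C10 f -> bounded_cont 0 T f.
Proof. by move=> [[_ cf _ _ _] _ _]; exact: bounded_cont_continuous. Qed.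

Lemma C10_bounded_cont_derive1 f : C10 f -> bounded_cont 0 T (derive1 f).
Proof.
move=> Cf; split=> [x|]; first exact: C10_continuous_derive1.
have [[fT _ _ _ _] [_ _ _ dfoo _] _] := Cf.
have := sub_Lfun_finLfun dfoo; rewrite inE/= => foo.
exists (fine 'N[mu]_+oo[EFin \o (derive1 f \_ Tdom)]) => x xT.
apply: Lnorm_oo_le => //.
- exact: derive1_periodic.
- exact: C10_continuous_derive1.
- by rewrite fineK// ge0_fin_numE// Lnorm_ge0.
Qed.

Lemma integrable_setU (A B : set R) f : measurable A -> measurable B ->
  mu.-integrable A (EFin \o f) -> mu.-integrable B (EFin \o f) ->
  [disjoint A & B] -> mu.-integrable (A `|` B) (EFin \o f).
Proof.
move=> mA mB /integrableP[mfA fA] /integrableP[mfB fB] AB; apply/integrableP.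
have mf : measurable_fun (A `|` B) (EFin \o f) by apply/measurable_funU.
split => //; rewrite ge0_integral_setU//; first exact: lte_add_pinfty.
exact: measurableT_comp.
Qed.

Lemma Rintegral_bounded_cont_cat (a b c : R) f : a < b -> b < c ->
  bounded_cont a b f -> bounded_cont b c f ->
  \int[mu]_(x in `[a, c]) f x =
  \int[mu]_(x in `]a, b[) f x + \int[mu]_(x in `]b, c[) f x.
Proof.
move=> ab bc fab fbc.
have E : `[a, c]%classic = `[a, b] `|` `]b, c].
  by apply: itv_bndbnd_setU; rewrite bnd_simp ltW.
have D : [disjoint `[a, b]%classic & `]b, c]%classic].
  apply/disj_setPS => y [] /=; rewrite !in_itv/= => /andP[_ ?] /andP[? _].
  by exfalso; lra.
have iab := bounded_cont_integrable_cc fab.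
have ibc : mu.-integrable `]b, c] (EFin \o f).
  apply: integrableS (bounded_cont_integrable_cc fbc) => //.
  exact: subset_itv_oc_cc.
rewrite E Rintegral_setU//; last exact: integrable_setU.
congr (_ + _); first exact: Rintegral_bounded_cont_cc.
rewrite -Rintegral_itv_bndo_bndc//.
exact: bounded_cont_integrable.
Qed.

(** Both sides contain the integral over (0, pi). For the rest, a primitive of [f] on (pi, 2 pi),
    translated by one period, is a primitive of [f] on (- pi, 0), so the two integrals agree by the
    fundamental theorem. *)
Lemma Rintegral_periodic f : periodicT f -> bounded_cont 0 T f ->
  \int[mu]_(x in Tdom) f x = \int[mu]_(x in `]0, T[) f x.
Proof.
move=> fT bf; have [cf [M fM]] := bf; have p0 := pi_gt0 R.
have T2 : T = 2 * pi by rewrite mulr_natl.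
have sub (c d : R) : 0 <= c -> d <= T -> bounded_cont c d f.
  move=> c0 dT; have cd x : x \in `]c, d[ -> x \in `]0, T[.
    by rewrite !in_itv/= => /andP[? ?]; apply/andP; split; lra.
  by split=> [x /cd/cf//|]; exists M => x /cd/fM.
have bf0 : bounded_cont 0 pi f by apply: sub => //; lra.
have bf1 : bounded_cont pi T f by apply: sub => //; lra.
have bf2 : bounded_cont (- pi) 0 f.
  have sh x : x \in `]- pi, 0[ -> x + T \in `]pi, T[.
    by rewrite !in_itv/= => /andP[? ?]; apply/andP; split; lra.
  have [cf1 [K fK]] := bf1.
  split=> [x /sh/cf1|]; first exact: continuous_periodicB.
  by exists K => x /sh/fK; rewrite fT.
rewrite (Rintegral_bounded_cont_cat _ _ bf2 bf0)//; last lra.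
rewrite -[RHS]Rintegral_bounded_cont_cc//.
rewrite (Rintegral_bounded_cont_cat _ _ bf0 bf1)//; last first.
  by rewrite -mulr_natr; lra.
rewrite addrC; congr (_ + _).
have pT : pi < T by lra.
have f1i := bounded_cont_integrable_cc bf1.
pose H x := \int[mu]_(t in `[pi, x]) f t.
rewrite -(Rintegral_bounded_cont_cc bf1) -/(H T) -[RHS]subr0.
have incT : {in Interval (BLeft (- pi)) (BRight 0) &,
    {homo (fun z => z + T) : x y / x < y}} by move=> x y _ _ xy; rewrite ltrD2r.
have cT z : (z' + T) @[z' --> z] --> z + T.
  by apply: cvgD; [exact: cvg_id|exact: cvg_cst].
apply: (@bounded_cont_FTC2 _ (- pi) 0 f (H \o (fun z => z + T))) => //; first lra.
- move=> x; rewrite in_itv/= => /andP[xp x0].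
  have xTT : x + T < T by lra.
  have pxT : pi < x + T by lra.
  have cfx : {for x + T, continuous f} by apply: bf1.1; rewrite in_itv/= pxT.
  have [dH Hf] := continuous_FTC1_closed xTT f1i pxT cfx.
  rewrite -[f x]mulr1; apply: is_derive1_comp; last exact: is_derive_shift.
  by rewrite -fT -Hf derive1E; exact: derivableP.
- apply: (@increasing_cvg_at_right_comp _ _ _ _ (BRight 0)) incT _ _.
  + by rewrite bnd_simp; lra.
  + by apply: cvg_at_right_filter; exact: cT.
  + have -> : - pi + T = pi by lra.
    by apply: cvg_at_right_filter; exact: parameterized_integral_cvg_left pT f1i.
- apply: (@increasing_cvg_at_left_comp _ _ _ (BLeft (- pi))) incT _ _.
  + by rewrite bnd_simp; lra.
  + by apply: cvg_at_left_filter; exact: cT.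
  + by rewrite add0r; exact: parameterized_integral_cvg_at_left pT f1i.
Qed.

(** * The oriented primitive of a periodic function *)

Lemma prim00 f : prim0 f 0 = 0.
Proof. by rewrite /prim0 subrr. Qed.

(** Moving the base point to [- n] replaces the case distinction on the sign of x by one formula, to
    which the fundamental theorem applies also at x = 0. *)
Lemma prim0E f (n x : R) : continuous f -> 0 < n -> x \in `]- n, n[ ->
  prim0 f x = \int[mu]_(t in `[- n, x]) f t - \int[mu]_(t in `[- n, 0]) f t.
Proof.
move=> cf n0 xn; have Nn0 : - n < 0 by rewrite oppr_lt0.
move: (xn); rewrite in_itv/= => /andP[nx xn'].
have int c d : mu.-integrable `[c, d] (EFin \o f).
  exact/bounded_cont_integrable_cc/bounded_cont_continuous.
have oc c d : \int[mu]_(t in `]c, d]) f t = \int[mu]_(t in `[c, d]) f t.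
  rewrite Rintegral_itv_obnd_cbnd//; apply: integrableS (int c d) => //.
  exact: subset_itv_oc_cc.
have sub c d : - n < c -> c <= d ->
    \int[mu]_(t in `[- n, d]) f t - \int[mu]_(t in `[- n, c]) f t =
    \int[mu]_(t in `[c, d]) f t.
  move=> nc cd; rewrite -[RHS]oc.
  have := @Rintegral_itvB R f (BLeft (- n)) (BRight d) c (int _ _).
  by rewrite !bnd_simp => ->//; exact: ltW.
rewrite /prim0; have [x0|x0] := leP 0 x.
- have -> : \int[mu]_(y in `[x, 0]) f y = 0.
    move: x0; rewrite le_eqVlt => /predU1P[<-|x0].
      by rewrite set_itv1 Rintegral_set1.
    by rewrite set_itv_ge ?Rintegral_set0// bnd_simp -ltNge.
  by rewrite subr0; have := sub 0 x Nn0 x0 => <-.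
- have := sub _ _ nx (ltW x0) => <-.
  by rewrite set_itv_ge ?Rintegral_set0 ?bnd_simp -?ltNge//; lra.
Qed.

Lemma is_derive_prim0 f (x : R) : continuous f -> is_derive x 1 (prim0 f) (f x).
Proof.
move=> cf; pose n := `|x| + 1.
have n0 : 0 < n by rewrite /n ltr_wpDl.
have xn : x \in `]- n, n[ by rewrite in_itv/= -ltr_norml /n ltrDl.
apply: (@near_eq_is_derive _ _ _
  (fun x => \int[mu]_(t in `[- n, x]) f t - \int[mu]_(t in `[- n, 0]) f t)).
  near=> y; rewrite (@prim0E f n)//; near: y.
  exact: near_in_itvoo.
move: (xn); rewrite in_itv/= => /andP[nx xn'].
have fi : mu.-integrable `[- n, n] (EFin \o f).
  exact/bounded_cont_integrable_cc/bounded_cont_continuous.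
have [dH Hf] := continuous_FTC1_closed xn' fi nx (cf x).
rewrite -[f x]subr0; apply: is_deriveB.
by rewrite -Hf derive1E; exact: derivableP.
Unshelve. all: by end_near. Qed.

Lemma continuous_prim0 f : continuous f -> continuous (prim0 f).
Proof.
move=> cf x; apply: differentiable_continuous; apply/derivable1_diffP.
by have [] := is_derive_prim0 x cf.
Qed.

Lemma prim0_two_pi f : continuous f ->
  \int[mu]_(x in `]0, T[) f x = prim0 f T.
Proof.
move=> cf; have -> : prim0 f T = prim0 f T - prim0 f 0 by rewrite prim00 subr0.
apply: (@bounded_cont_FTC2 _ 0 T f (prim0 f)); first exact: two_pi_gt0.
- exact: bounded_cont_continuous.
- by move=> x _; exact: is_derive_prim0.
- by apply: cvg_at_right_filter; exact: continuous_prim0.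
- by apply: cvg_at_left_filter; exact: continuous_prim0.
Qed.

(** By periodicity of [f], the increment over one period has zero derivative, so it equals its value
    at 0. *)
Lemma prim0_periodic f (x : R) : continuous f -> periodicT f ->
  prim0 f (x + T) = prim0 f x + prim0 f T.
Proof.
move=> cf fT; pose D y := prim0 f (y + T) - prim0 f y.
suff /(is_derive_0_is_cst x 0) : forall y : R, is_derive y 1 D 0.
  by rewrite /D add0r prim00 subr0 => <-; rewrite [RHS]addrC subrK.
move=> y; rewrite -(subrr (f y)); apply: is_deriveB.
  rewrite -[f y]mulr1; apply: (@is_derive1_comp _ (prim0 f) (shift T)); last first.
    exact: is_derive_shift.
  by rewrite /= -fT; exact: is_derive_prim0.
exact: is_derive_prim0.
Qed.

End periodic.

(** * Differentiation in time *)

(** Differentiability from within [0, +oo) as a bound on the first-order remainder: it is one-sided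
    at t = 0 and involves no division, so it passes to integrals and squares by plain estimates. *)
Definition has_dt {R : realType} (E : R -> R) (t e : R) : Prop :=
  forall eps, 0 < eps -> exists2 d, 0 < d & forall s, 0 <= s -> `|s - t| < d ->
    `|E s - E t - (s - t) * e| <= eps * `|s - t|.

(** The same remainder bound, uniform in x: this is what convergence in the W^{1,oo} norm gives for
    both v and v_x. *)
Definition unif_dt {R : realType} (a b : R) (f : R -> R -> R) (t : R)
    (g : R -> R) : Prop :=
  forall eps, 0 < eps -> exists2 d, 0 < d & forall s, 0 <= s -> `|s - t| < d ->
    forall x, x \in `]a, b[ ->
      `|f s x - f t x - (s - t) * g x| <= eps * `|s - t|.

Section time_derivative.
Context {R : realType}.
Implicit Types E f g : R -> R.
Notation mu := (@lebesgue_measure R).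

Lemma has_dt_is_derive E (t e : R) : 0 < t -> has_dt E t e -> is_derive t 1 E e.
Proof.
move=> t0 dE.
suff : h^-1 *: ((E \o shift t) (h *: 1) - E t) @[h --> 0^'] --> e.
  move=> cE; apply: DeriveDef; first exact: cvgP cE.
  by apply/cvg_lim.
apply/cvgrPdist_le => eps eps0; have [d d0 Hd] := dE _ eps0.
near=> h.
have h0 : h != 0 by near: h; exact: nbhs_dnbhs_neq.
have hd : `|h| < d.
  by near: h; apply: dnbhs0_lt.
have ht : `|h| < t by near: h; apply: dnbhs0_lt.
have s0 : 0 <= h + t by move: ht; rewrite ltr_norml => /andP[? ?]; lra.
have := Hd (h + t) s0; rewrite addrK => /(_ hd).
rewrite /= scaler1 /GRing.scale/= => H.
have -> : e - h^-1 * (E (h + t) - E t) = - ((E (h + t) - E t - h * e) / h).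
  by field.
by rewrite normrN normrM normfV ler_pdivrMr ?normr_gt0.
Unshelve. all: by end_near. Qed.

(** A remainder of at most [s] makes [E] Lipschitz at 0, with constant 1 + |e|. *)
Lemma has_dt_cvg_right0 E e : has_dt E 0 e -> E s @[s --> 0^'+] --> E 0.
Proof.
move=> /(_ 1 ltr01)[d d0 Hd].
apply/cvgrPdist_le => eps eps0; pose K := 1 + `|e|.
have K0 : 0 < K by rewrite /K ltr_wpDr.
near=> s.
have s0 : 0 < s by near: s; exact: nbhs_right_gt.
have sd : s < d by near: s; exact: nbhs_right_lt.
have sK : s < eps / K by near: s; apply: nbhs_right_lt; rewrite divr_gt0.
have := Hd s (ltW s0); rewrite subr0 gtr0_norm// => /(_ sd); rewrite mul1r => H.
rewrite distrC; have -> : E s - E 0 = (E s - E 0 - s * e) + s * e by rewrite subrK.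
rewrite (le_trans (ler_normD _ _))// normrM (gtr0_norm s0).
move: sK; rewrite ltr_pdivlMr// /K => ?; lra.
Unshelve. all: by end_near. Qed.

Variables a b : R.
Hypothesis ab : a < b.
Notation J f := (\int[mu]_(x in `]a, b[) f x).

Lemma unif_dt_Rintegral (f : R -> R -> R) t g :
  (forall s, 0 <= s -> bounded_cont a b (f s)) -> bounded_cont a b g -> 0 <= t ->
  unif_dt a b f t g -> has_dt (fun s => J (f s)) t (J g).
Proof.
move=> bf bg t0 df eps eps0.
have e0 : 0 < eps / (b - a) by rewrite divr_gt0// subr_gt0.
have [d d0 Hd] := df _ e0; exists d => // s s0 sd.
have b1 : bounded_cont a b (fun x => f s x - f t x).
  by apply: bounded_contB; exact: bf.
have b2 : bounded_cont a b (fun x => (s - t) * g x).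
  by apply: bounded_contM => //; exact: bounded_cont_cst.
rewrite -Rintegral_bounded_contB ?bf//; [|exact: bf|exact: bf].
rewrite -Rintegral_bounded_contZ// -Rintegral_bounded_contB//.
have -> : eps * `|s - t| = eps / (b - a) * `|s - t| * (b - a).
  by rewrite mulrAC divfK// gt_eqF// subr_gt0.
apply: normr_Rintegral_bounded; first exact: ltW.
  exact: (bounded_contB b1 b2).1.
exact: Hd.
Qed.

Lemma unif_dt_energy (f : R -> R -> R) t g rho :
  (forall s, 0 <= s -> bounded_cont a b (f s)) -> bounded_cont a b g ->
  bounded_cont a b rho -> 0 <= t -> unif_dt a b f t g ->
  has_dt (fun s => J (fun x => rho x * f s x ^+ 2)) t
         (J (fun x => rho x * (2 * f t x * g x))).
Proof.
move=> bf bg br t0 df.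
apply: (@unif_dt_Rintegral (fun s x => rho x * f s x ^+ 2)) => //.
- move=> s s0; apply: bounded_contM => //.
  by apply: bounded_contM; exact: bf.
- apply: bounded_contM => //; apply: bounded_contM => //; apply: bounded_contM.
    exact: bounded_cont_cst.
  exact: bf.
move=> eps eps0.
have [_ [Mr HMr]] := br; have [_ [Mg HMg]] := bg; have [_ [Mf HMf]] := bf _ t0.
(* With r the first-order remainder of [f], that of rho f^2 is rho (2 f r + (r + (s - t) g)^2). Once
   |r| <= e |s - t|, |s - t| < e and e <= 1, it is at most K e |s - t|; the added 1's keep K
   positive. *)
pose K := (`|Mr| + 1) * (2 * `|Mf| + (1 + `|Mg|) ^+ 2).
have K0 : 0 < K.
  apply: mulr_gt0; first by rewrite ltr_wpDl.
  by rewrite ltr_wpDl ?mulr_ge0// exprn_gt0// ltr_wpDr.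
pose e := Num.min 1 (eps / K).
have e0 : 0 < e by rewrite lt_min ltr01 divr_gt0.
have [d d0 Hd] := df _ e0.
exists (Num.min d e) => [|s s0]; first by rewrite lt_min d0.
rewrite lt_min => /andP[sd se] x xab.
have eK : K * e <= eps.
  by rewrite mulrC -ler_pdivlMr// /e ge_min lexx orbT.
have := Hd s s0 sd x xab.
set r := f s x - f t x - (s - t) * g x => Hr.
have -> : rho x * f s x ^+ 2 - rho x * f t x ^+ 2 -
    (s - t) * (rho x * (2 * f t x * g x)) =
  rho x * (2 * f t x * r + (r + (s - t) * g x) ^+ 2) by rewrite /r; ring.
have e1 : e <= 1 by rewrite /e ge_min lexx.
have gx : `|g x| <= `|Mg| by exact: le_trans (HMg _ xab) (ler_norm _).
have fx : `|f t x| <= `|Mf| by exact: le_trans (HMf _ xab) (ler_norm _).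
have rx : `|rho x| <= `|Mr| + 1.
  by rewrite (le_trans (HMr _ xab))// (le_trans (ler_norm _))// lerDl.
have H1 : `|2 * f t x * r| <= 2 * `|Mf| * (e * `|s - t|).
  by rewrite !normrM ger0_norm// ler_pM// ?mulr_ge0// ler_pM.
have H2 : `|(r + (s - t) * g x) ^+ 2| <= (1 + `|Mg|) ^+ 2 * (e * `|s - t|).
  have H : `|r + (s - t) * g x| <= (1 + `|Mg|) * `|s - t|.
    rewrite (le_trans (ler_normD _ _))// [leRHS]mulrDl lerD//.
      by rewrite (le_trans Hr)// ler_wpM2r.
    by rewrite normrM mulrC ler_wpM2r.
  rewrite normrX; apply: (@le_trans _ _ (((1 + `|Mg|) * `|s - t|) ^+ 2)).
    by rewrite ler_pXn2r ?nnegrE// ?mulr_ge0// addr_ge0.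
  rewrite exprMn; apply: ler_wpM2l; first exact: sqr_ge0.
  by rewrite expr2 ler_wpM2r// ltW.
rewrite normrM (@le_trans _ _ (K * (e * `|s - t|)))//; last first.
  by rewrite mulrA ler_wpM2r.
rewrite /K -[leRHS]mulrA ler_pM// (le_trans (ler_normD _ _))// [leRHS]mulrDl lerD//.
Qed.

End time_derivative.

(** * Hyperbolic weights *)

Definition phi {R : realType} (x : R) : R := cosh (pi - x) / sinh pi.
Definition psi {R : realType} (x : R) : R := - sinh (pi - x) / sinh pi.

(** * Derivation rules for pointwise expressions *)

Section derivation_rules.
Context {R : realType}.
Implicit Types (f g : R -> R) (x : R).

Lemma is_derive1_cst (k x : R) : is_derive x 1 (fun=> k) (0 : R).
Proof. exact: is_derive_cst. Qed.

Lemma is_derive1_eq f x (df df' : R) :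
  is_derive x 1 f df -> df = df' -> is_derive x 1 f df'.
Proof. by move=> fd <-. Qed.

Lemma is_derive1D f g x (df dg : R) : is_derive x 1 f df -> is_derive x 1 g dg ->
  is_derive x 1 (fun y => f y + g y) (df + dg).
Proof. exact: is_deriveD. Qed.

Lemma is_derive1N f x (df : R) : is_derive x 1 f df ->
  is_derive x 1 (fun y => - f y) (- df).
Proof. exact: is_deriveN. Qed.

Lemma is_derive1M f g x (df dg : R) : is_derive x 1 f df -> is_derive x 1 g dg ->
  is_derive x 1 (fun y => f y * g y) (df * g x + f x * dg).
Proof.
move=> fd gd; have := is_deriveM fd gd.
by rewrite /GRing.scale/= addrC [g x * _]mulrC.
Qed.

Lemma is_derive1V f x (df : R) : f x != 0 -> is_derive x 1 f df ->
  is_derive x 1 (fun y => (f y)^-1) (- df / f x ^+ 2).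
Proof.
move=> fx0 fd; have := is_deriveV fx0 fd; rewrite /GRing.scale/=.
by rewrite mulNr [X in - X]mulrC -mulNr.
Qed.

End derivation_rules.

(** The derivative is left open and built by the rules. Facts from the context are tried first, so
    that functions whose derivative is known there act as atoms. *)
Ltac derive_rules :=
  solve [repeat first [eassumption
    | notypeclasses refine (is_derive1_cst _ _)
    | notypeclasses refine (is_derive1D _ _)
    | notypeclasses refine (is_derive1N _)
    | notypeclasses refine (is_derive1M _ _)]].

(** * Identities, sign and derivatives of the hyperbolic functions *)

Section hyperbolic.
Context {R : realType}.
Implicit Types x : R.
Notation T := (pi *+ 2 : R).

(** In terms of p = e^pi and e^x every quantity is a rational function, which leaves the identities
    to [field]; the nonvanishing facts discharge its side conditions. *)
Let p := expR pi : R.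
Let p_gt1 : 1 < p. Proof. by rewrite expR_gt1 pi_gt0. Qed.
Let p_gt0 : 0 < p. Proof. exact: expR_gt0. Qed.
Let p_neq0 : p != 0. Proof. by rewrite gt_eqF. Qed.

Let expRpiB x : expR (pi - x) = p / expR x. Proof. by rewrite expRD expRN. Qed.
Let expR2pi : expR T = p ^+ 2. Proof. by rewrite mulr2n expRD. Qed.
Let expRNpiB x : expR (- (pi - x)) = expR x / p.
Proof. by rewrite opprB expRD expRN. Qed.
Let p2_neq1 : p * p - 1 != 0.
Proof. by rewrite gt_eqF// subr_gt0 -[ltLHS]mulr1 ltr_pM. Qed.

Let sinh_piE : sinh pi = (p * p - 1) / (2 * p) :> R.
Proof. by rewrite /sinh expRN -/p; field. Qed.

Let x_neq0 x : expR x != 0. Proof. by rewrite gt_eqF ?expR_gt0. Qed.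

Let phiE x : phi x = (p * p + expR x ^+ 2) / ((p * p - 1) * expR x).
Proof.
rewrite /phi sinh_piE /cosh expRpiB expRNpiB.
by field; rewrite p_neq0 x_neq0 p2_neq1.
Qed.

Let psiE x : psi x = (expR x ^+ 2 - p * p) / ((p * p - 1) * expR x).
Proof.
rewrite /psi sinh_piE /sinh expRpiB expRNpiB.
by field; rewrite p_neq0 x_neq0 p2_neq1.
Qed.

Lemma phi0 : phi 0 = cconst :> R.
Proof. by rewrite /phi /cconst /peakon normr0. Qed.

Let cE : cconst = (p * p + 1) / (p * p - 1) :> R.
Proof. by rewrite -phi0 phiE expR0 expr1n mulr1. Qed.

Let mE : mconst = 2 * p / (p * p - 1) :> R.
Proof. by rewrite /mconst sinh_piE; field; rewrite p_neq0 p2_neq1. Qed.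

Lemma phi_2pi : phi T = cconst.
Proof.
by rewrite phiE cE expR2pi; field; rewrite p_neq0 p2_neq1.
Qed.

Lemma psi0 : psi 0 = -1 :> R.
Proof. by rewrite psiE expR0; field. Qed.

Lemma psi_2pi : psi T = 1.
Proof. by rewrite psiE expR2pi; field; rewrite p_neq0 p2_neq1. Qed.

Lemma cosh0 : cosh 0 = 1 :> R.
Proof. by rewrite /cosh oppr0 expR0; field. Qed.

Lemma sinh0 : sinh 0 = 0 :> R.
Proof. by rewrite /sinh oppr0 subrr mul0r. Qed.

(** cosh(2 pi) - 1 = 2 sinh(pi)^2. This normalisation of the forcing term is what cancels the
    boundary terms in the balances of the mean and of N and Q. *)
Lemma cosh_2pi : mconst ^+ 2 * (cosh T - 1) = 2.
Proof. by rewrite /cosh mE expRN expR2pi; field; rewrite p_neq0 p2_neq1. Qed.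

Lemma cconst_mconst : cconst ^+ 2 - mconst ^+ 2 = 1 :> R.
Proof. by rewrite cE mE; field. Qed.

Lemma phi_psi x : phi x ^+ 2 - psi x ^+ 2 = mconst ^+ 2.
Proof. by rewrite phiE psiE mE; field; rewrite x_neq0 p2_neq1. Qed.

(** The addition formula for sinh at (pi - x) + x, divided by sinh(pi); the next identity is the one
    for cosh. *)
Lemma psi_cosh_sinh x : psi x * cosh x - phi x * sinh x = -1.
Proof. by rewrite phiE psiE /cosh /sinh expRN; field; rewrite x_neq0 p2_neq1. Qed.

Lemma phi_cosh_sinh x : phi x * cosh x - psi x * sinh x = cconst.
Proof. by rewrite phiE psiE cE /cosh /sinh expRN; field; rewrite x_neq0 p2_neq1. Qed.

(** Sum-to-product: sinh(x - 2 pi) - sinh(x) = - 2 cosh(pi - x) sinh(pi). It measures the jump of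
    the forcing term when a point is moved by one period. *)
Lemma sinhB_2pi x : mconst ^+ 2 / 2 * (sinh (x - T) - sinh x) = - phi x.
Proof.
have E : expR (x - T) = expR x / p ^+ 2 by rewrite expRD expRN expR2pi.
have E' : expR (- (x - T)) = p ^+ 2 / expR x by rewrite opprB expRD expRN expR2pi.
rewrite /sinh E E' expRN phiE mE.
by field; rewrite x_neq0 p2_neq1 p_neq0.
Qed.

Lemma phi_lt_cconst x : x \in `]0, T[ -> phi x < cconst.
Proof.
rewrite in_itv/= => /andP[x0 xT]; rewrite -subr_gt0.
(* The numerator is quadratic in e^x, with its roots at the two ends x = 0 and x = 2 pi. *)
have -> : cconst - phi x =
    (expR x - 1) * (p ^+ 2 - expR x) / ((p * p - 1) * expR x).
  by rewrite phiE cE; field; rewrite x_neq0 p2_neq1.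
rewrite divr_gt0// mulr_gt0 ?expR_gt0// subr_gt0 ?expR_gt1//.
  by rewrite -expR2pi ltr_expR.
by rewrite -[ltLHS]mulr1 ltr_pM.
Qed.

Lemma is_derive_cosh x : is_derive x 1 cosh (sinh x).
Proof.
have dN : is_derive x 1 (fun y : R => expR (- y)) (- expR (- x)).
  by rewrite -mulrN1; apply: (@is_derive1_comp _ expR (fun y => - y)).
have dE := is_derive_expR x.
notypeclasses refine (@is_derive1_eq _
  (fun y : R => (expR y + expR (- y)) * 2^-1) _ _ _ _ _).
  derive_rules.
by rewrite mulr0 addr0 /sinh.
Qed.

Lemma is_derive_sinh x : is_derive x 1 sinh (cosh x).
Proof.
have dN : is_derive x 1 (fun y : R => expR (- y)) (- expR (- x)).
  by rewrite -mulrN1; apply: (@is_derive1_comp _ expR (fun y => - y)).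
have dE := is_derive_expR x.
notypeclasses refine (@is_derive1_eq _
  (fun y : R => (expR y - expR (- y)) * 2^-1) _ _ _ _ _).
  derive_rules.
by rewrite mulr0 addr0 opprK /cosh.
Qed.

Let is_derive_piB x : is_derive x 1 (fun y : R => pi - y) (- 1).
Proof.
rewrite -[- 1]add0r; apply: is_derive1D.
Qed.

Lemma is_derive_phi x : is_derive x 1 phi (psi x).
Proof.
have dc : is_derive x 1 (fun y : R => cosh (pi - y)) (sinh (pi - x) * -1).
  exact: (@is_derive1_comp _ cosh (fun y => pi - y) x _ _
    (is_derive_cosh _) (is_derive_piB x)).
notypeclasses refine (@is_derive1_eq _
  (fun y : R => cosh (pi - y) * (sinh pi)^-1) _ _ _ _ _).
  derive_rules.
by rewrite mulr0 addr0 mulrN1 /psi.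
Qed.

Lemma is_derive_psi x : is_derive x 1 psi (phi x).
Proof.
have dc : is_derive x 1 (fun y : R => sinh (pi - y)) (cosh (pi - x) * -1).
  exact: (@is_derive1_comp _ sinh (fun y => pi - y) x _ _
    (is_derive_sinh _) (is_derive_piB x)).
notypeclasses refine (@is_derive1_eq _
  (fun y : R => - sinh (pi - y) * (sinh pi)^-1) _ _ _ _ _).
  derive_rules.
by rewrite mulr0 addr0 mulrN1 opprK /phi.
Qed.

Lemma is_derive1_continuous (f df : R -> R) :
  (forall x, is_derive x 1 f (df x)) -> continuous f.
Proof.
move=> fd x; apply: differentiable_continuous; apply/derivable1_diffP.
by have [] := fd x.
Qed.

Lemma continuous_phi : continuous (@phi R).
Proof. exact: is_derive1_continuous is_derive_phi. Qed.

Lemma continuous_psi : continuous (@psi R).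
Proof. exact: is_derive1_continuous is_derive_psi. Qed.

Lemma continuous_cosh : continuous (@cosh R).
Proof. exact: is_derive1_continuous is_derive_cosh. Qed.

Lemma continuous_sinh : continuous (@sinh R).
Proof. exact: is_derive1_continuous is_derive_sinh. Qed.

End hyperbolic.

(** * Energy identities *)

Section circle.
Context {R : realType}.
Implicit Types f g : R -> R.
Notation mu := (@lebesgue_measure R).
Notation T := (pi *+ 2 : R).
Notation J f := (\int[mu]_(x in `]0, T[) f x).

Lemma continuous_add f g : continuous f -> continuous g ->
  continuous (fun x => f x + g x).
Proof. by move=> cf cg x; apply: cvgD; [exact: cf|exact: cg]. Qed.

Lemma continuous_opp f : continuous f -> continuous (fun x => - f x).
Proof. by move=> cf x; apply: cvgN; exact: cf. Qed.

Lemma continuous_mul f g : continuous f -> continuous g ->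
  continuous (fun x => f x * g x).
Proof. by move=> cf cg x; apply: cvgM; [exact: cf|exact: cg]. Qed.

Lemma cvg_mul_bounded f g (F : set_system R) (M : R) : Filter F ->
  f x @[x --> F] --> 0 -> (\forall x \near F, `|g x| <= M) ->
  f x * g x @[x --> F] --> 0.
Proof.
move=> FF f0 gM; apply/cvgr0Pnorm_le => eps eps0.
have M0 : 0 < `|M| + 1 by rewrite ltr_wpDl.
have /cvgr0Pnorm_le/(_ (eps / (`|M| + 1)) (divr_gt0 eps0 M0)) H := f0.
near=> x; rewrite normrM.
apply: (@le_trans _ _ (eps / (`|M| + 1) * (`|M| + 1))).
  apply: ler_pM => //; first by near: x.
  by rewrite (@le_trans _ _ M)//; [near: x|rewrite (le_trans (ler_norm _))// lerDl].
by rewrite divfK// gt_eqF.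
Unshelve. all: by end_near. Qed.

(* [B] need not have limits at the end points: only its bound matters. *)
Lemma circle_FTC2 g (eta B H : R -> R) : bounded_cont 0 T g ->
  continuous eta -> eta 0 = 0 -> eta T = 0 -> bounded_cont 0 T B -> continuous H ->
  (forall x, x \in `]0, T[ -> is_derive x 1 (fun y => eta y * B y + H y) (g x)) ->
  J g = H T - H 0.
Proof.
move=> bg ceta eta0 etaT [_ [M BM]] cH dG.
apply: (@bounded_cont_FTC2 _ 0 T g (fun y => eta y * B y + H y)) => //.
- exact: two_pi_gt0.
- rewrite -[H 0]add0r; apply: cvgD; last exact/cvg_at_right_filter/cH.
  apply: (@cvg_mul_bounded _ _ _ M).
    by have := cvg_at_right_filter (ceta 0); rewrite eta0.
  near=> x; apply: BM; rewrite in_itv/=; apply/andP; split.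
    by near: x; exact: nbhs_right_gt.
  by near: x; apply: nbhs_right_lt; exact: two_pi_gt0.
- rewrite -[H T]add0r; apply: cvgD; last exact/cvg_at_left_filter/cH.
  apply: (@cvg_mul_bounded _ _ _ M).
    by have := cvg_at_left_filter (ceta T); rewrite etaT.
  near=> x; apply: BM; rewrite in_itv/=; apply/andP; split.
    by near: x; apply: nbhs_left_gt; exact: two_pi_gt0.
  by near: x; exact: nbhs_left_lt.
Unshelve. all: by end_near. Qed.

Lemma bounded_cont_sqr (a b : R) f : bounded_cont a b f ->
  bounded_cont a b (fun x => f x ^+ 2).
Proof. by move=> bf; exact: (bounded_contM bf bf). Qed.

(** Brings an energy balance under one integral sign, where its integrand can be recognised as an
    exact derivative; [k] and [l] receive the coefficients of the balance. *)
Lemma Rintegral_bounded_cont_comb (a b k l : R) (A B C D E F : R -> R) :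
  bounded_cont a b A -> bounded_cont a b B -> bounded_cont a b C ->
  bounded_cont a b D -> bounded_cont a b E -> bounded_cont a b F ->
  \int[mu]_(x in `]a, b[) A x + \int[mu]_(x in `]a, b[) B x +
  k * (\int[mu]_(x in `]a, b[) C x + \int[mu]_(x in `]a, b[) D x) +
  l * (\int[mu]_(x in `]a, b[) E x + \int[mu]_(x in `]a, b[) F x) =
  \int[mu]_(x in `]a, b[) (A x + B x + k * (C x + D x) + l * (E x + F x)).
Proof.
move=> bA bB bC bD bE bF.
have bAB := bounded_contD bA bB.
have bCD := bounded_contD bC bD; have bEF := bounded_contD bE bF.
have bkCD := bounded_contM (bounded_cont_cst a b k) bCD.
have blEF := bounded_contM (bounded_cont_cst a b l) bEF.
rewrite (Rintegral_bounded_contD (bounded_contD bAB bkCD) blEF).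
rewrite (Rintegral_bounded_contD bAB bkCD) (Rintegral_bounded_contD bA bB).
rewrite (Rintegral_bounded_contZ k bCD) (Rintegral_bounded_contZ l bEF).
by rewrite (Rintegral_bounded_contD bC bD) (Rintegral_bounded_contD bE bF).
Qed.

End circle.

Ltac bounded_cont_rules :=
  match goal with
  | |- bounded_cont ?a ?b (fun _ => ?k) => exact (bounded_cont_cst a b k)
  | |- bounded_cont ?a ?b (fun x => ?f x) =>
      change (bounded_cont a b f); bounded_cont_rules
  | |- bounded_cont _ _ (fun x => @GRing.add _ (@?f x) (@?g x)) =>
      refine (@bounded_contD _ _ _ f g _ _); bounded_cont_rules
  | |- bounded_cont _ _ (fun x => @GRing.opp _ (@?f x)) =>
      refine (@bounded_contN _ _ _ f _); bounded_cont_rules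
  | |- bounded_cont _ _ (fun x => @GRing.mul _ (@?f x) (@?g x)) =>
      refine (@bounded_contM _ _ _ f g _ _); bounded_cont_rules
  | |- bounded_cont _ _ (fun x => @GRing.exp _ (@?f x) 2) =>
      refine (@bounded_cont_sqr _ _ _ f _); bounded_cont_rules
  | H : bounded_cont _ _ ?f |- bounded_cont _ _ ?f => exact H
  end.

Ltac continuous_rules :=
  match goal with
  | |- continuous (fun _ => ?k) => exact (@cst_continuous _ _ k)
  | |- continuous (fun x => ?f x) => change (continuous f); continuous_rules
  | |- continuous (fun x => @GRing.add _ (@?f x) (@?g x)) =>
      refine (@continuous_add _ f g _ _); continuous_rules
  | |- continuous (fun x => @GRing.opp _ (@?f x)) =>
      refine (@continuous_opp _ f _); continuous_rules
  | |- continuous (fun x => @GRing.mul _ (@?f x) (@?g x)) =>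
      refine (@continuous_mul _ f g _ _); continuous_rules
  | H : continuous ?f |- continuous ?f => exact H
  end.

(** * Balance laws of the mean and of the three energies *)

Section identities.
Context {R : realType}.
Notation mu := (@lebesgue_measure R).
Notation T := (pi *+ 2 : R).
Notation J f := (\int[mu]_(x in `]0, T[) f x).
Variables f g : R -> R.
Hypotheses (Cf : C10 f) (Cg : C10 g).
Notation W := (prim0 f).
Notation f' := (derive1 f).
Notation g' := (derive1 g).
Notation c := (@cconst R).
Notation m := (@mconst R).
Let k := m ^+ 2 / 2 * W T.
Hypothesis eqg : forall x, x \in `]0, T[ ->
  g x = (c - phi x) * f' x + phi x * W x - k * sinh x.

Let cf : continuous f. Proof. by have [[]] := Cf. Qed.
Let cW : continuous W. Proof. exact: continuous_prim0. Qed.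
Let cphi := @continuous_phi R.
Let cpsi := @continuous_psi R.
Let csinh := @continuous_sinh R.
Let ccosh := @continuous_cosh R.
Let bf := C10_bounded_cont Cf.
Let bg := C10_bounded_cont Cg.
Let bf' := C10_bounded_cont_derive1 Cf.
Let bg' := C10_bounded_cont_derive1 Cg.
Let bW := bounded_cont_continuous 0 T cW.
Let bphi := bounded_cont_continuous 0 T cphi.
Let bpsi := bounded_cont_continuous 0 T cpsi.

(* On (0, 2 pi) the factor [c - phi] does not vanish, so the equation itself
   provides the second space derivative. *)
Lemma second_derivative x : x \in `]0, T[ ->
  exists2 f2, is_derive x 1 f' f2 &
    g' x = (c - phi x) * f2 - psi x * f' x + psi x * W x + phi x * f x
           - k * cosh x.
Proof.
move=> xT; have x0 : c - phi x != 0.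
  by rewrite gt_eqF// subr_gt0 phi_lt_cconst.
have dphi := is_derive_phi x; have dsinh := is_derive_sinh x.
have dW := is_derive_prim0 x cf; have dg := C10_derive Cg xT.
have dV : is_derive x 1 (fun y => (c - phi y)^-1) (psi x / (c - phi x) ^+ 2).
  notypeclasses refine (@is_derive1_eq _ _ _
    (- (0 - psi x) / (c - phi x) ^+ 2) _ _ _).
    notypeclasses refine (@is_derive1V _ (fun y => c - phi y) x _ x0 _).
    derive_rules.
  by rewrite sub0r opprK.
(* [n] is [f'] solved from the equation; it is built from differentiable functions only, [g]
   included since it lies in [C10]. [f2] is the resulting derivative. *)
pose n x := (g x - phi x * W x + k * sinh x) * (c - phi x)^-1.
pose f2 := (g' x + psi x * f' x - psi x * W x - phi x * f x + k * cosh x)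
  / (c - phi x).
exists f2; last by rewrite /f2; field.
apply: (@near_eq_is_derive _ _ _ n).
  have : \forall y \near x, y \in `]0, T[ by exact: near_in_itvoo.
  apply: filterS => y yT; rewrite /n eqg//; field.
  by rewrite gt_eqF// subr_gt0 phi_lt_cconst.
notypeclasses refine (@is_derive1_eq _ _ _ _ _ _ _).
  derive_rules.
by rewrite /f2 eqg//; field.
Qed.

Lemma f_2pi : f T = f 0.
Proof. by have [[fT _ _ _ _] _ _] := Cf; rewrite -[T]add0r fT. Qed.

Let cosh_T : k * (cosh T - 1) = W T.
Proof.
transitivity (m ^+ 2 * (cosh T - 1) / 2 * W T); first by rewrite /k; field.
by rewrite cosh_2pi divff ?mul1r.
Qed.

(* The weight [rho * (c - phi)] vanishes at the peak. *)
Let peak_FTC2 (h rho B H : R -> R) : bounded_cont 0 T h -> continuous rho ->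
  bounded_cont 0 T B -> continuous H ->
  (forall x, x \in `]0, T[ ->
     is_derive x 1 (fun y => rho y * (c - phi y) * B y + H y) (h x)) ->
  J h = H T - H 0.
Proof.
move=> bh crho bB cH dG.
notypeclasses refine (@circle_FTC2 _ h (fun y => rho y * (c - phi y)) B H
  bh _ _ _ bB cH dG).
- continuous_rules.
- by rewrite phi0 subrr mulr0.
- by rewrite phi_2pi subrr mulr0.
Qed.

(** The right-hand side is the derivative of (c - phi) f + psi W - k cosh, whose boundary term W(2
    pi) - k (cosh(2 pi) - 1) vanishes. *)
Lemma mean_rate : J g = 0.
Proof.
pose H x := psi x * W x - k * cosh x.
have -> : J g = H T - H 0.
  notypeclasses refine (@peak_FTC2 g (fun=> 1) f H bg _ bf _ _).
  - continuous_rules.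
  - rewrite /H; continuous_rules.
  move=> x xT; have dphi := is_derive_phi x; have dpsi := is_derive_psi x.
  have dcosh := is_derive_cosh x; have dW := is_derive_prim0 x cf.
  have df := C10_derive Cf xT.
  notypeclasses refine (@is_derive1_eq _ _ _ _ _ _ _); first derive_rules.
  by rewrite eqg//; ring.
by rewrite /H psi_2pi psi0 prim00 cosh0 -cosh_T; ring.
Qed.

Notation E rho f := (J (fun x => rho x * f x ^+ 2)).
Notation D rho f g := (J (fun x => rho x * (2 * f x * g x))).

(** The terms 2 (c - phi) f f' + 2 phi f f' add up to c (f^2)', so f^2 survives only through the
    nonlocal part 2 phi W f + 2 psi W f' = 2 (psi W f)' - 2 psi f^2: hence the weight 2 psi.
    Integrating 2 (c - phi) f' f'' by parts reduces - 2 psi f'^2 to - psi f'^2. *)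
Lemma energy_one :
  D (fun=> 1) f g + D (fun=> 1) f' g' =
  - (E (fun x => 2 * psi x) f + E psi f').
Proof.
(* The part of the primitive that is continuous up to the peak; the other part, (c - phi) f'^2,
   leaves no boundary term. *)
pose H x := c * (f x * f x) + 2 * (psi x * (W x * f x)) - 2 * (k * (f x * cosh x)).
have := @Rintegral_bounded_cont_comb R 0 T 1 0
  (fun x => 1 * (2 * f x * g x)) (fun x => 1 * (2 * f' x * g' x))
  (fun x => 2 * psi x * f x ^+ 2) (fun x => psi x * f' x ^+ 2)
  (fun=> 0) (fun=> 0).
rewrite [J (fun x => _ + _ + _ + _)](_ : _ = H T - H 0); last first.
  notypeclasses refine (@peak_FTC2 _ (fun=> 1) (fun x => f' x * f' x) H _ _ _ _ _).
  - bounded_cont_rules.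
  - continuous_rules.
  - bounded_cont_rules.
  - rewrite /H; continuous_rules.
  move=> x xT; have dphi := is_derive_phi x; have dpsi := is_derive_psi x.
  have dcosh := is_derive_cosh x; have dW := is_derive_prim0 x cf.
  have df := C10_derive Cf xT; have [f2 df' eg'] := second_derivative xT.
  notypeclasses refine (@is_derive1_eq _ _ _ _ _ _ _); first derive_rules.
  by rewrite eqg// eg'; ring.
have -> : H T - H 0 = 0.
  rewrite /H psi_2pi psi0 prim00 cosh0 f_2pi.
  transitivity (2 * f 0 * (W T - k * (cosh T - 1))); first ring.
  by rewrite cosh_T subrr mulr0.
rewrite mul0r addr0 mul1r => HJ.
by apply/eqP; rewrite -addr_eq0 HJ//; bounded_cont_rules.
Qed.

(** Integration by parts leaves the nonlocal remainder 2 (phi^2 - psi^2) W f and the forcing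
    remainder 2 k (psi cosh - phi sinh) f. The hyperbolic identities turn them into (m^2 W^2)' and -
    2 k W', whose boundary terms cancel because 2 k = m^2 W(2 pi). *)
Lemma energy_phi :
  D (fun x => 2 * phi x) f g + D phi f' g' =
  - (c * (E (fun x => 2 * psi x) f + E psi f')).
Proof.
pose H x := 2 * (phi x * (psi x * (W x * f x))) + phi x * (phi x * (f x * f x))
  - 2 * (k * (phi x * (cosh x * f x))) + 2 * (phi x * ((c - phi x) * (f x * f x)))
  + m ^+ 2 * (W x * W x) - 2 * (k * W x).
have := @Rintegral_bounded_cont_comb R 0 T c 0
  (fun x => 2 * phi x * (2 * f x * g x)) (fun x => phi x * (2 * f' x * g' x))
  (fun x => 2 * psi x * f x ^+ 2) (fun x => psi x * f' x ^+ 2)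
  (fun=> 0) (fun=> 0).
rewrite [J (fun x => _ + _ + _ + _)](_ : _ = H T - H 0); last first.
  notypeclasses refine (@peak_FTC2 _ phi (fun x => f' x * f' x) H _ cphi _ _ _).
  - bounded_cont_rules.
  - bounded_cont_rules.
  - rewrite /H; continuous_rules.
  move=> x xT; have dphi := is_derive_phi x; have dpsi := is_derive_psi x.
  have dcosh := is_derive_cosh x; have dW := is_derive_prim0 x cf.
  have df := C10_derive Cf xT; have [f2 df' eg'] := second_derivative xT.
  notypeclasses refine (@is_derive1_eq _ _ _ _ _ _ _); first derive_rules.
  rewrite eqg// eg' -(phi_psi x).
  apply/eqP; rewrite -subr_eq0; apply/eqP.
  transitivity (- 2 * k * f x * (psi x * cosh x - phi x * sinh x + 1)); first ring.
  by rewrite psi_cosh_sinh addNr mulr0.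
have -> : H T - H 0 = 0.
  rewrite /H phi_2pi phi0 psi_2pi psi0 prim00 cosh0 f_2pi.
  transitivity (2 * c * f 0 * (W T - k * (cosh T - 1))
                + W T * (m ^+ 2 * W T - 2 * k)); first ring.
  by rewrite cosh_T subrr mulr0 add0r /k; field.
rewrite mul0r addr0 => HJ.
by apply/eqP; rewrite -addr_eq0 HJ//; bounded_cont_rules.
Qed.

(** Here the system closes: integration by parts gives f'^2 the weight phi^2 - psi^2 - c phi = m^2 -
    c phi, and f^2 the weight m^2 - 2 c phi, so no new energy appears. The forcing leaves 2 k c f =
    2 k c W'. Boundary terms survive, but they depend only on W(2 pi) and f(0). *)
Lemma energy_psi :
  D (fun x => 2 * psi x) f g + D psi f' g' =
  m ^+ 2 * (E (fun=> 1) f + E (fun=> 1) f')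
  - c * (E (fun x => 2 * phi x) f + E phi f')
  + (2 * W T * f 0 + 2 * c * f 0 ^+ 2 - 2 * k * f 0 * (cosh T + 1)
     + 2 * k * c * W T).
Proof.
pose H x := 2 * (psi x * (psi x * (W x * f x))) + phi x * (psi x * (f x * f x))
  - 2 * (k * (psi x * (cosh x * f x))) + 2 * (psi x * ((c - phi x) * (f x * f x)))
  + 2 * (k * (c * W x)).
have := @Rintegral_bounded_cont_comb R 0 T (- m ^+ 2) c
  (fun x => 2 * psi x * (2 * f x * g x)) (fun x => psi x * (2 * f' x * g' x))
  (fun x => 1 * f x ^+ 2) (fun x => 1 * f' x ^+ 2)
  (fun x => 2 * phi x * f x ^+ 2) (fun x => phi x * f' x ^+ 2).
rewrite [J (fun x => _ + _ + _ + _)](_ : _ = H T - H 0); last first.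
  notypeclasses refine (@peak_FTC2 _ psi (fun x => f' x * f' x) H _ cpsi _ _ _).
  - bounded_cont_rules.
  - bounded_cont_rules.
  - rewrite /H; continuous_rules.
  move=> x xT; have dphi := is_derive_phi x; have dpsi := is_derive_psi x.
  have dcosh := is_derive_cosh x; have dW := is_derive_prim0 x cf.
  have df := C10_derive Cf xT; have [f2 df' eg'] := second_derivative xT.
  notypeclasses refine (@is_derive1_eq _ _ _ _ _ _ _); first derive_rules.
  rewrite eqg// eg' -(phi_psi x).
  apply/eqP; rewrite -subr_eq0; apply/eqP.
  transitivity (2 * k * f x * (c - (phi x * cosh x - psi x * sinh x))); first ring.
  by rewrite phi_cosh_sinh subrr mulr0.
have -> : H T - H 0 = 2 * W T * f 0 + 2 * c * f 0 ^+ 2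
    - 2 * k * f 0 * (cosh T + 1) + 2 * k * c * W T.
  by rewrite /H phi_2pi phi0 psi_2pi psi0 prim00 cosh0 f_2pi; ring.
have comb (a1 a2 a3 a4 r : R) :
    a1 + a2 + - m ^+ 2 * a3 + c * a4 = r -> a1 + a2 = m ^+ 2 * a3 - c * a4 + r.
  by move=> <-; ring.
by move=> HJ; apply: comb; apply: HJ; bounded_cont_rules.
Qed.

End identities.

(** * Evolution of the energies *)

Section evolution.
Context {R : realType}.
Implicit Types (f g E N P Q : R -> R) (v vt : R -> R -> R) (t : R).
Notation mu := (@lebesgue_measure R).
Notation T := (pi *+ 2 : R).
Notation J f := (\int[mu]_(x in `]0, T[) f x).

(** The error of the difference quotient is small in the W^{1,oo} norm. It and its derivative are
    continuous on (0, 2 pi), so these essential bounds hold at every point there. *)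
Lemma C10_unif_dt v vt t : C1_time_C10 v vt -> 0 <= t ->
  unif_dt 0 T v t (vt t) /\
  unif_dt 0 T (fun s => derive1 (v s)) t (derive1 (vt t)).
Proof.
move=> vC t0.
suff H eps : 0 < eps -> exists2 d, 0 < d & forall s, 0 <= s -> `|s - t| < d ->
    forall x : R, x \in `]0, T[ ->
    `|v s x - v t x - (s - t) * vt t x| <= eps * `|s - t| /\
    `|derive1 (v s) x - derive1 (v t) x - (s - t) * derive1 (vt t) x|
       <= eps * `|s - t|.
  split=> eps /H[d d0 Hd]; exists d => // s s0 sd x xT.
    by have [] := Hd _ s0 sd _ xT.
  by have [] := Hd _ s0 sd _ xT.
move=> eps0.
pose h s x := (v s x - v t x) / (s - t) - vt t x.
have [Ct Cvt cn _] := vC _ t0.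
have B : nbhs (0%E : \bar R) [set y | (y < eps%:E)%E].
  by apply: open_nbhs_nbhs; split; [exact: open_ereal_lt_ereal|rewrite /= lte_fin].
have /nbhs_ballP[d /= d0 Hd] : nbhs t (fun s => s != t ->
    `[0, +oo[%classic s -> (W1ooNorm (h s) < eps%:E)%E) := cn _ B.
exists d => // s s0 sd x xT.
have [->|st] := eqVneq s t; first by rewrite !subrr !mul0r subr0 normr0 mulr0.
have [Cs _ _ _] := vC _ s0.
have hd : `[0, +oo[%classic s by rewrite /= in_itv/= s0.
have bts : ball t d s by rewrite /ball/= distrC.
have hN := Hd s bts st hd.
have [[sT cs _ _ _] _ _] := Cs; have [[tT ct _ _ _] _ _] := Ct.
have [[vtT cvt _ _ _] _ _] := Cvt.
have hT : periodicT (h s) by move=> y; rewrite /h sT tT vtT.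
pose h' y := (derive1 (v s) y - derive1 (v t) y) / (s - t) - derive1 (vt t) y.
(* The norm sees the derivative of the quotient; it is identified with the quotient of the
   derivatives only off the peak. *)
have dh y : y \in `]0, T[ -> derive1 (h s) y = h' y.
  move=> yT; rewrite derive1E; apply: derive_val.
  have ds := C10_derive Cs yT; have dt := C10_derive Ct yT.
  have dvt := C10_derive Cvt yT.
  notypeclasses refine (@is_derive1_eq _ _ _ _ _ _ _); first derive_rules.
  by rewrite mulr0 addr0.
have ch : continuous (h s).
  rewrite /h; continuous_rules.
have bh' : bounded_cont 0 T h'.
  have bs := C10_bounded_cont_derive1 Cs; have bt := C10_bounded_cont_derive1 Ct.
  have bvt := C10_bounded_cont_derive1 Cvt.
  rewrite /h'; bounded_cont_rules.
have cdh : derive1 (h s) y @[y --> x] --> derive1 (h s) x.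
  rewrite (dh x)//; apply: cvg_trans (bh'.1 _ xT).
  apply: near_eq_cvg.
  have : \forall y \near x, y \in `]0, T[ by exact: near_in_itvoo.
  by apply: filterS => y yT; rewrite dh.
have N1 : ('N[mu]_+oo[EFin \o (h s \_ Tdom)] <= eps%:E)%E.
  apply: le_trans (ltW hN); rewrite /W1ooNorm leeDl//; exact: Lnorm_ge0.
have N2 : ('N[mu]_+oo[EFin \o (derive1 (h s) \_ Tdom)] <= eps%:E)%E.
  apply: le_trans (ltW hN); rewrite /W1ooNorm leeDr//; exact: Lnorm_ge0.
have st0 : s - t != 0 by rewrite subr_eq0.
have H1 := Lnorm_oo_le hT xT (ch x) N1.
have := Lnorm_oo_le (derive1_periodic hT) xT cdh N2.
rewrite dh// => H2.
have K (a b : R) : `|a / (s - t) - b| <= eps -> `|a - (s - t) * b| <= eps * `|s - t|.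
  have -> : a - (s - t) * b = (a / (s - t) - b) * (s - t) by field.
  by move=> ?; rewrite normrM ler_wpM2r.
by split; apply: K.
Qed.

Lemma meanT_prim0 f : continuous f -> periodicT f ->
  pi * mconst ^+ 2 * meanT f = mconst ^+ 2 / 2 * prim0 f T.
Proof.
move=> cf fT; rewrite /meanT Rintegral_periodic ?prim0_two_pi//; last first.
  exact: bounded_cont_continuous.
have E (p a b : R) : p != 0 -> p * a * ((2 * p)^-1 * b) = a / 2 * b.
  by move=> p0; field.
by rewrite E// gt_eqF// pi_gt0.
Qed.

(* Crossing [pi], the jumps of [prim0 f] and of [sinh] compensate, so that the
   equation has smooth coefficients on (0, 2 pi). *)
Lemma lin_rhs_circle f g : C10 f -> periodicT g ->
  (forall x : R, Tdom x -> x != 0 -> g x = lin_rhs f x) ->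
  forall x : R, x \in `]0, T[ -> g x = (cconst - phi x) * derive1 f x
    + phi x * prim0 f x - mconst ^+ 2 / 2 * prim0 f T * sinh x.
Proof.
move=> Cf gT eqg x xT; have [[fT cf _ _ _] _ _] := Cf.
have p0 := pi_gt0 R; have pn0 : pi != 0 :> R by rewrite gt_eqF.
have T2 : T = 2 * pi by rewrite mulr_natl.
move: (xT); rewrite in_itv/= => /andP[x0 xlT].
have [xp|px] := leP x pi.
  rewrite eqg ?gt_eqF//; last by rewrite /Tdom/= in_itv/=; apply/andP; split; lra.
  by rewrite /lin_rhs meanT_prim0// /peakon (gtr0_norm x0) -/(phi x).
have xT0 : x - T < 0 by lra.
rewrite -(periodicTB x gT) eqg; last 2 first.
- by rewrite /Tdom/= in_itv/=; apply/andP; split; lra.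
- by rewrite lt_eqF.
rewrite /lin_rhs meanT_prim0// (periodicTB x (derive1_periodic fT)).
have -> : peakon (x - T) = phi x.
  rewrite /peakon (ltr0_norm xT0) /phi; congr (_ / _).
  have -> : pi - - (x - T) = - (pi - x) by rewrite T2; ring.
  by rewrite /cosh opprK addrC.
have -> : prim0 f (x - T) = prim0 f x - prim0 f T.
  by rewrite -{2}(subrK T x) prim0_periodic// addrK.
have E := sinhB_2pi x.
have -> : phi x * (prim0 f x - prim0 f T) =
    phi x * prim0 f x + mconst ^+ 2 / 2 * (sinh (x - T) - sinh x) * prim0 f T.
  by rewrite E; ring.
by ring.
Qed.

(** As x tends to 0 from the right, c - phi tends to 0 while f' stays bounded, and W and sinh vanish
    at 0. Continuity of [g] gives its value at the peak, where the equation is not posed. *)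
Lemma peak_rate f g : C10 f -> continuous g ->
  (forall x : R, x \in `]0, T[ -> g x = (cconst - phi x) * derive1 f x
    + phi x * prim0 f x - mconst ^+ 2 / 2 * prim0 f T * sinh x) ->
  g 0 = 0.
Proof.
move=> Cf cg eqg; have [[fT cf _ _ _] _ _] := Cf.
pose k := mconst ^+ 2 / 2 * prim0 f T.
have [_ [M fM]] := C10_bounded_cont_derive1 Cf.
have near0 : \forall x \near (0 : R)^'+, x \in `]0, T[.
  near=> x; rewrite in_itv/=; apply/andP; split.
    by near: x; exact: nbhs_right_gt.
  by near: x; apply: nbhs_right_lt; exact: two_pi_gt0.
have cW := continuous_prim0 cf.
have cphi := @continuous_phi R; have csinh := @continuous_sinh R.
have c1 : (cconst - phi x) * derive1 f x @[x --> (0 : R)^'+] --> 0.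
  apply: (@cvg_mul_bounded _ _ _ _ M).
    have ceta : continuous (fun x : R => cconst - phi x) by continuous_rules.
    by have := cvg_at_right_filter (ceta 0); rewrite phi0 subrr.
  by apply: filterS near0 => x /fM.
have c2 : phi x * prim0 f x - k * sinh x @[x --> (0 : R)^'+] --> 0.
  have cr : continuous (fun x : R => phi x * prim0 f x - k * sinh x).
    by continuous_rules.
  have := cvg_at_right_filter (cr 0).
  by rewrite prim00 sinh0 !mulr0 subrr.
have cg0 : g x @[x --> (0 : R)^'+] --> g 0 by exact/cvg_at_right_filter/cg.
suff g0 : g x @[x --> (0 : R)^'+] --> 0 by exact: (cvg_unique _ cg0 g0).
have := cvgD c1 c2; rewrite addr0 => c3; apply: cvg_trans (c3 _).
apply: near_eq_cvg; apply: filterS near0 => x xT.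
by rewrite eqg// addrA.
Unshelve. all: by end_near. Qed.

Lemma derive0_cst_ge0 E : (forall t, 0 < t -> is_derive t 1 E (0 : R)) ->
  E s @[s --> (0 : R)^'+] --> E 0 -> forall t, 0 <= t -> E t = E 0.
Proof.
move=> dE cE t; rewrite le_eqVlt => /predU1P[<-//|t0].
have ct : E s @[s --> (0 : R)^'+] --> E t.
  apply: cvg_near_cst; near=> s.
  apply: (@is_derive0_cst_oo _ 0 (t + 1) E).
  - by move=> z; rewrite in_itv/= => /andP[z0 _]; exact: dE.
  - rewrite in_itv/=; apply/andP; split; near: s.
      exact: nbhs_right_gt.
    by apply: nbhs_right_lt; rewrite ltr_wpDl// ltW.
  - by rewrite in_itv/= t0/= ltrDl.
exact: (cvg_unique _ ct cE).
Unshelve. all: by end_near. Qed.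

Lemma linear_system N P Q (c m K : R) : c ^+ 2 - m ^+ 2 = 1 ->
  (forall t, 0 < t -> is_derive t 1 N (- P t)) ->
  (forall t, 0 < t -> is_derive t 1 P (m ^+ 2 * N t - c * Q t + K)) ->
  (forall t, 0 < t -> is_derive t 1 Q (- (c * P t))) ->
  N s @[s --> (0 : R)^'+] --> N 0 -> P s @[s --> (0 : R)^'+] --> P 0 ->
  Q s @[s --> (0 : R)^'+] --> Q 0 ->
  exists C : R * R * R, forall t, 0 <= t ->
    N t = C.1.1 * expR t + C.1.2 + C.2 * expR (- t).
Proof.
move=> cm dN dP dQ cN cP cQ.
have L t : 0 <= t -> Q t - c * N t = Q 0 - c * N 0.
  apply: (@derive0_cst_ge0 (fun t => Q t - c * N t)).
    move=> {}t t0; have ? := dN _ t0; have ? := dQ _ t0.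
    notypeclasses refine (@is_derive1_eq _ _ _ _ _ _ _); first derive_rules.
    by rewrite /=; ring.
  by apply: cvgB => //; apply: cvgM => //; exact: cvg_cst.
(* Obtained by inserting the conserved value of Q - c N into P'. *)
pose k := K - c * (Q 0 - c * N 0).
have dP' t : 0 < t -> is_derive t 1 P (k - N t).
  move=> t0; have dPt := dP _ t0.
  notypeclasses refine (@is_derive1_eq _ _ _ _ _ dPt _).
  have -> : Q t = Q 0 - c * N 0 + c * N t by rewrite -(L _ (ltW t0)) subrK.
  by rewrite -[N t in RHS]mul1r -cm /k; ring.
have cexp : expR s @[s --> (0 : R)^'+] --> expR 0.
  exact/cvg_at_right_filter/continuous_expR.
have dexpN (t : R) : is_derive t 1 (fun y : R => expR (- y)) (- expR (- t)).
  by rewrite -mulrN1; apply: (@is_derive1_comp _ expR (fun y => - y)).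
have cexpN : expR (- s) @[s --> (0 : R)^'+] --> expR (- 0).
  exact/cvg_at_right_filter/(is_derive1_continuous dexpN).
(* N - k + P and N - k - P are the eigenmodes of the reduced system, with rates -1 and 1; multiplied
   by the inverse exponentials they become constants, and N - k is half their sum. *)
pose U t := (N t - k + P t) * expR t.
pose V t := (N t - k - P t) * expR (- t).
have U0 t : 0 <= t -> U t = U 0.
  apply: derive0_cst_ge0 => [{}t t0|].
    have ? := dN _ t0; have ? := dP' _ t0; have ? := is_derive_expR t.
    notypeclasses refine (@is_derive1_eq _ _ _ _ _ _ _); first derive_rules.
    by rewrite /=; ring.
  apply: cvgM => //; apply: cvgD => //; apply: cvgB => //; exact: cvg_cst.
have V0 t : 0 <= t -> V t = V 0.
  apply: derive0_cst_ge0 => [{}t t0|].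
    have ? := dN _ t0; have ? := dP' _ t0; have ? := dexpN t.
    notypeclasses refine (@is_derive1_eq _ _ _ _ _ _ _); first derive_rules.
    by rewrite /=; ring.
  apply: cvgM => //; apply: cvgB => //; apply: cvgB => //; exact: cvg_cst.
exists (V 0 / 2, k, U 0 / 2) => t t0 /=.
rewrite -(U0 _ t0) -(V0 _ t0) /U /V expRN.
have e0 : expR t != 0 by rewrite gt_eqF ?expR_gt0.
by field.
Qed.

End evolution.

(** * The energies along a solution *)

Section solution.
Context {R : realType}.
Notation mu := (@lebesgue_measure R).
Notation T := (pi *+ 2 : R).
Notation J f := (\int[mu]_(x in `]0, T[) f x).
Notation E rho f := (J (fun x => rho x * f x ^+ 2)).
Notation D rho f g := (J (fun x => rho x * (2 * f x * g x))).

Lemma H1sqnorm_circle (f : R -> R) : C10 f ->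
  H1sqnorm f = E (fun=> 1) f + E (fun=> 1) (derive1 f).
Proof.
move=> Cf; have bf := C10_bounded_cont Cf; have bf' := C10_bounded_cont_derive1 Cf.
have [[fT _ _ _ _] _ _] := Cf.
rewrite /H1sqnorm Rintegral_periodic; first 1 last.
- by move=> x; rewrite fT derive1_periodic.
- by bounded_cont_rules.
rewrite Rintegral_bounded_contD; [|bounded_cont_rules|bounded_cont_rules].
by congr (_ + _); apply: eq_Rintegral => x _; rewrite mul1r.
Qed.

Variables (v0 : R -> R) (v : R -> R -> R).
Hypothesis hv : is_solution v0 v.

Lemma H1sqnorm_exp : exists C : R * R * R, forall t, 0 <= t ->
  H1sqnorm (v t) = C.1.1 * expR t + C.1.2 + C.2 * expR (- t).
Proof.
have [vt vC [eqv _]] := hv.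
have Cv (t : R) : 0 <= t -> C10 (v t) by move=> /vC[].
have Cvt (t : R) : 0 <= t -> C10 (vt t) by move=> /vC[].
have eqc (t : R) : 0 < t -> forall x : R, x \in `]0, T[ ->
    vt t x = (cconst - phi x) * derive1 (v t) x + phi x * prim0 (v t) x
             - mconst ^+ 2 / 2 * prim0 (v t) T * sinh x.
  move=> t0; apply: lin_rhs_circle; first exact/Cv/ltW.
    by have [[]] := Cvt _ (ltW t0).
  by move=> x; exact: eqv.
have bv (t : R) : 0 <= t -> bounded_cont 0 T (v t) by move=> /Cv/C10_bounded_cont.
have bv' (t : R) : 0 <= t -> bounded_cont 0 T (derive1 (v t)).
  by move=> /Cv/C10_bounded_cont_derive1.
have bvt (t : R) : 0 <= t -> bounded_cont 0 T (vt t) by move=> /Cvt/C10_bounded_cont.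
have bvt' (t : R) : 0 <= t -> bounded_cont 0 T (derive1 (vt t)).
  by move=> /Cvt/C10_bounded_cont_derive1.
have b1 : bounded_cont 0 T (fun=> 1 : R) by exact: bounded_cont_cst.
have bphi := bounded_cont_continuous 0 T (@continuous_phi R).
have bpsi := bounded_cont_continuous 0 T (@continuous_psi R).
have b2phi : bounded_cont 0 T (fun x => 2 * phi x) by bounded_cont_rules.
have b2psi : bounded_cont 0 T (fun x => 2 * psi x) by bounded_cont_rules.
have dE rho (t : R) : bounded_cont 0 T rho -> 0 <= t ->
    has_dt (fun s => E rho (v s)) t (D rho (v t) (vt t)).
  move=> brho t0; apply: unif_dt_energy => //; [exact: two_pi_gt0|exact: bvt|].
  by have [] := C10_unif_dt vC t0.
have dE' rho (t : R) : bounded_cont 0 T rho -> 0 <= t ->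
    has_dt (fun s => E rho (derive1 (v s))) t
      (D rho (derive1 (v t)) (derive1 (vt t))).
  move=> brho t0.
  apply: (@unif_dt_energy _ _ _ _ (fun s => derive1 (v s))) => //.
  - exact: two_pi_gt0.
  - exact: bvt'.
  - by have [] := C10_unif_dt vC t0.
have cE rho rho' : bounded_cont 0 T rho -> bounded_cont 0 T rho' ->
    E rho (v s) + E rho' (derive1 (v s)) @[s --> (0 : R)^'+] -->
    E rho (v 0) + E rho' (derive1 (v 0)).
  move=> br br'; apply: cvgD.
    exact: has_dt_cvg_right0 (dE _ _ br (lexx 0)).
  exact: has_dt_cvg_right0 (dE' _ _ br' (lexx 0)).
have dEE rho rho' (t : R) : bounded_cont 0 T rho -> bounded_cont 0 T rho' -> 0 < t ->
    is_derive t 1 (fun s => E rho (v s) + E rho' (derive1 (v s)))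
      (D rho (v t) (vt t) + D rho' (derive1 (v t)) (derive1 (vt t))).
  move=> br br' t0; apply: is_derive1D.
    exact: has_dt_is_derive t0 (dE _ _ br (ltW t0)).
  exact: has_dt_is_derive t0 (dE' _ _ br' (ltW t0)).
have mean_cst (t : R) : 0 <= t -> prim0 (v t) T = prim0 (v 0) T.
  have dJ (s : R) : 0 <= s -> has_dt (fun s => J (v s)) s (J (vt s)).
    move=> s0; apply: unif_dt_Rintegral => //; [exact: two_pi_gt0|exact: bvt|].
    by have [] := C10_unif_dt vC s0.
  move=> t0; have cv s : 0 <= s -> continuous (v s) by move=> /Cv[[]].
  rewrite -!prim0_two_pi//; [|exact: cv|exact: cv].
  apply: (@derive0_cst_ge0 _ (fun s => J (v s))) => // [s s0|].
    have := has_dt_is_derive s0 (dJ _ (ltW s0)).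
    by rewrite (mean_rate (Cv _ (ltW s0)) (Cvt _ (ltW s0)) (eqc _ s0)).
  exact: has_dt_cvg_right0 (dJ _ (lexx 0)).
have peak_cst (t : R) : 0 <= t -> v t 0 = v 0 0.
  (* The peak is not in (0, 2 pi), so the uniform remainder bound is passed to it by continuity in
     x. *)
  have dv (s : R) : 0 <= s -> has_dt (fun s => v s 0) s (vt s 0).
    move=> s0 eps eps0; have [dv _] := C10_unif_dt vC s0.
    have [d d0 Hd] := dv _ eps0; exists d => // r r0 rd.
    have cr : continuous (v r) by have [[]] := Cv _ r0.
    have cs : continuous (v s) by have [[]] := Cv _ s0.
    have cvs : continuous (vt s) by have [[]] := Cvt _ s0.
    have ch : continuous (fun x : R => v r x - v s x - (r - s) * vt s x).
      by continuous_rules.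
    have := cvg_norm (cvg_at_right_filter (ch 0)) => cn.
    apply: (cvgr_to_le (cn _)).
    near=> x; apply: Hd => //; rewrite in_itv/=; apply/andP; split.
      by near: x; exact: nbhs_right_gt.
    by near: x; apply: nbhs_right_lt; exact: two_pi_gt0.
  apply: (@derive0_cst_ge0 _ (fun s => v s 0)) => // [s s0|].
    have cvs : continuous (vt s) by have [[]] := Cvt _ (ltW s0).
    have := has_dt_is_derive s0 (dv _ (ltW s0)).
    by rewrite (peak_rate (Cv _ (ltW s0)) cvs (eqc _ s0)).
  exact: has_dt_cvg_right0 (dv _ (lexx 0)).
have := @linear_system _ (fun t => E (fun=> 1) (v t) + E (fun=> 1) (derive1 (v t)))
  (fun t => E (fun x => 2 * psi x) (v t) + E psi (derive1 (v t)))
  (fun t => E (fun x => 2 * phi x) (v t) + E phi (derive1 (v t)))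
  cconst mconst _ (@cconst_mconst R) _ _ _ (cE _ _ b1 b1) (cE _ _ b2psi bpsi)
  (cE _ _ b2phi bphi).
(* The constant K is the boundary term in the balance of P, with the conserved W(2 pi) and peak
   value taken at t = 0. *)
pose b := prim0 (v 0) T; pose a := v 0 0; pose k := mconst ^+ 2 / 2 * b.
move=> /(_ (2 * b * a + 2 * cconst * a ^+ 2 - 2 * k * a * (cosh T + 1)
            + 2 * k * cconst * b)) [t t0|t t0|t t0|C HC].
- rewrite -(energy_one (Cv _ (ltW t0)) (Cvt _ (ltW t0)) (eqc _ t0)).
  exact: dEE.
- have := energy_psi (Cv _ (ltW t0)) (Cvt _ (ltW t0)) (eqc _ t0).
  rewrite (mean_cst _ (ltW t0)) (peak_cst _ (ltW t0)) => <-.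
  exact: dEE.
- rewrite -(energy_phi (Cv _ (ltW t0)) (Cvt _ (ltW t0)) (eqc _ t0)).
  exact: dEE.
by exists C => t t0; rewrite H1sqnorm_circle ?HC//; exact: Cv.
Unshelve. all: by end_near. Qed.

End solution.

(** With x = e^t >= 1 the identity reads a x + b + c / x = 0, and x = 1, 2, 4 already give a
    nonsingular linear system. *)
Lemma expR_combination_eq0 {R : realType} (a b c : R) :
  (forall t, 0 <= t -> a * expR t + b + c * expR (- t) = 0) ->
  [/\ a = 0, b = 0 & c = 0].
Proof.
move=> H.
have Hx (x : R) : 1 <= x -> a * x + b + c / x = 0.
  move=> x1; have x0 : x \is Num.pos by rewrite posrE (lt_le_trans ltr01).
  by have := H (ln x) (ln_ge0 x1); rewrite expRN lnK.
have := Hx 1 (lexx 1); have := Hx 2 _; have := Hx 4 _.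
have -> : c / 1 = c by field.
rewrite !ler1n => /(_ isT) H4 /(_ isT) H2 H1.
by split; lra.
Qed.

Theorem lemma3p6 (R : realType) (v0 : R -> R) (v : R -> R -> R)
    (hv0 : C10 v0) (hv : is_solution v0 v) :
  exists! C : R * R * R, forall t : R, 0 <= t ->
    let: (Cp, C0, Cm) := C in
    H1sqnorm (v t) = Cp * expR t + C0 + Cm * expR (- t).
Proof.
have [[[Cp C0] Cm] HC] := H1sqnorm_exp hv.
exists (Cp, C0, Cm); split=> [//|[[Dp D0] Dm] HD].
have [] := @expR_combination_eq0 R (Cp - Dp) (C0 - D0) (Cm - Dm).
  move=> t t0; have := HC t t0; rewrite HD//= => E.
  by rewrite !mulrBl; move: E; lra.
by move=> /subr0_eq -> /subr0_eq -> /subr0_eq ->.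
Qed.
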